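(* Let $(V_1,V_2)$ be a pure pair of commuting isometries on a Hilbert space $\mathcal{H}$. Then the BCL pair $(M_{\Phi_1},M_{\Phi_2})$ corresponding to $(V_1,V_2)$ is given, for $z\in\mathbb{D}$, by $$\Phi_1(z) = U^*(P_{\mathcal{W}_2}+zP_{\mathcal{W}_2}^\perp)\qquad\text{and}\qquad \Phi_2(z) = (P_{\mathcal{W}_2}^\perp+zP_{\mathcal{W}_2})U,$$ where $$U=\begin{bmatrix}V_2|_{\mathcal{W}_1}&0\\0&V_1^*|_{V_1\mathcal{W}_2}\end{bmatrix}:\ \mathcal{W}_1\oplus V_1\mathcal{W}_2\to V_2\mathcal{W}_1\oplus\mathcal{W}_2$$ is a unitary operator on $\mathcal{W}$.
   Context: $\mathbb{D}$ is the open unit disc. An isometry is pure (a shift) if the powers of its adjoint tend to $0$ in the strong operator topology. For commuting isometries $(V_1,V_2)$ on $\mathcal{H}$ put $V=V_1V_2$, $\mathcal{W}=\mathcal{H}\ominus V\mathcal{H}$, $\mathcal{W}_j=\mathcal{H}\ominus V_j\mathcal{H}$ ($j=1,2$). One has the orthogonal decompositions $\mathcal{W}=\mathcal{W}_1\oplus V_1\mathcal{W}_2 = V_2\mathcal{W}_1\oplus\mathcal{W}_2$. The pair $(V_1,V_2)$ is called pure if $V$ is a pure isometry. Here $P_{\mathcal{W}_2}$ is the orthogonal projection of $\mathcal{W}$ onto $\mathcal{W}_2$ and $P_{\mathcal{W}_2}^\perp = I_{\mathcal{W}}-P_{\mathcal{W}_2}$. For a Hilbert space $\mathcal{E}$,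 $H^2_{\mathcal{E}}(\mathbb{D})$ is the Hilbert space of $\mathcal{E}$-valued analytic functions on $\mathbb{D}$ with square-summable Taylor coefficients, $H^\infty_{\mathcal{B}(\mathcal{E})}(\mathbb{D})$ is the space of bounded $\mathcal{B}(\mathcal{E})$-valued holomorphic functions on $\mathbb{D}$, and $M_\Theta f = \Theta f$ for $\Theta\in H^\infty_{\mathcal{B}(\mathcal{E})}(\mathbb{D})$, $f\in H^2_{\mathcal{E}}(\mathbb{D})$. For the pure isometry $V$, $\Pi_V:\mathcal{H}\to H^2_{\mathcal{W}}(\mathbb{D})$ is the Wold-von Neumann unitary determined by $\Pi_V(V^m\eta)=z^m\eta$ ($m\ge0$, $\eta\in\mathcal{W}$). The BCL (Berger-Coburn-Lebow) pair corresponding to a pure pair $(V_1,V_2)$ is the pair $(M_{\Phi_1},M_{\Phi_2})$ on $H^2_{\mathcal{W}}(\mathbb{D})$, where $\Phi_1,\Phi_2\in H^\infty_{\mathcal{B}(\mathcal{W})}(\mathbb{D})$ are the (unique) multipliers with $\Pi_VV_i = M_{\Phi_i}\Pi_V$ for $i=1,2$; they exist because $V_i$ commutes with $V$. *)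

(* Defs.v *)
From HB Require Import structures.
From mathcomp Require Import all_boot all_order all_algebra sesquilinear.
From mathcomp Require Import complex.
From mathcomp Require Import boolp classical_sets functions reals topology.
From mathcomp Require Import tvs normedtype sequences.

Set Implicit Arguments.
Unset Strict Implicit.
Unset Printing Implicit Defensive.

Import Order.TTheory GRing.Theory Num.Theory.
Import numFieldNormedType.Exports.

Local Open Scope classical_set_scope.
Local Open Scope ring_scope.
Local Open Scope complex_scope.

(* Complex Hilbert spaces; the inner product is linear in its first argument. *)
HB.mixin Record isHilbert (R : realType) H & CompleteNormedModule R[i] H := {
  inner : {dot H for (@Num.conj R[i])} ;
  inner_norm : forall x : H, inner x x = `|x| ^+ 2
}.

#[short(type="hilbertType")]
HB.structure Definition Hilbert (R : realType) :=
  {H of CompleteNormedModule R[i] H & isHilbert R H}.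

Section Operators.
Context {R : realType}.
Implicit Types E F : hilbertType R.

Definition bounded_operator E F (T : E -> F) := linear T /\ continuous T.

(* [xget] picks the unique vector given by the Riesz representation theorem;
   the default value 0 is only reached when [T] has no adjoint at [y]. *)
Definition adjoint E F (T : E -> F) (y : F) : E :=
  xget 0 [set x | forall u, inner (T u) y = inner u x].

(* Orthogonal projection of [x] onto [A], the default value 0 being only
   reached when there is none (never the case for a closed subspace). *)
Definition proj E (A : set E) (x : E) : E :=
  xget 0 [set p | A p /\ forall a, A a -> inner (x - p) a = 0].

Definition unitary_operator E (T : E -> E) :=
  [/\ bounded_operator T, cancel T (adjoint T) & cancel (adjoint T) T].

Definition pure_operator E (T : E -> E) :=
  forall x, (fun n => iter n (adjoint T) x) @ \oo --> (0 : E).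

End Operators.

(* Closed subspaces, regarded as Hilbert spaces. *)
Record closed_subspace (R : realType) (H : hilbertType R) := ClosedSubspace {
  csset :> set H ;
  cs0 : csset 0 ;
  csP : forall (a : R[i]) x y, csset x -> csset y -> csset (a *: x + y) ;
  cs_closed : closed csset
}.

Section SubHilbert.
Context {R : realType} {H : hilbertType R} (S : closed_subspace H).

Definition cspred : {pred H} := fun x => `[< csset S x >].

Lemma cspredP x : reflect (csset S x) (x \in cspred).
Proof. exact: asboolP. Qed.

Lemma cspred_submod : submod_closed cspred.
Proof.
split; first by apply/cspredP; exact: cs0.
by move=> a x y /cspredP Sx /cspredP Sy; apply/cspredP; exact: csP.
Qed.

HB.instance Definition _ := GRing.isSubmodClosed.Build R[i] H cspred
  cspred_submod.

Record subhilbert := SubHilbert { subval : H ; subvalP : subval \in cspred }.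

HB.instance Definition _ := [isSub for subval].
HB.instance Definition _ := [Choice of subhilbert by <:].
HB.instance Definition _ := [SubChoice_isSubLmodule of subhilbert by <:].


Definition subnorm (x : subhilbert) := `|subval x|.

Fact ler_subnormD x y : subnorm (x + y) <= subnorm x + subnorm y.
Proof. exact: ler_normD. Qed.

Fact subnormZ (a : R[i]) x : subnorm (a *: x) = `|a| * subnorm x.
Proof. exact: normrZ. Qed.

Fact subnorm0_eq0 x : subnorm x = 0 -> x = 0.
Proof. by move=> /normr0_eq0 x0; exact/val_inj. Qed.

HB.instance Definition _ := Lmodule_isNormed.Build R[i] subhilbert
  ler_subnormD subnormZ subnorm0_eq0.

Fact sub_complete (F : set_system subhilbert) :
  ProperFilter F -> cauchy F -> cvg F.
Proof.
move=> FF /cauchyP Fc.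
have Gc : cauchy (subval @ F).
  apply/cauchyP => e e0; have [x Fx] := Fc _ e0.
  exists (subval x); rewrite /fmap /=; apply: (filterS _ Fx) => y /=.
  by rewrite -!ball_normE /=.
have /cvg_ex[l Gl] : cvg (subval @ F) by exact: cauchy_cvg.
have Sl : l \in cspred.
  apply/cspredP; apply: (@closed_cvg _ _ F _ subval (csset S) _ _ _ Gl).
    exact: cs_closed.
  by apply: nearW => y; exact/cspredP/subvalP.
apply/cvg_ex; exists (SubHilbert Sl); apply/cvgrPdist_lt => e e0.
by move/cvgrPdist_lt : Gl => /(_ _ e0).
Qed.

HB.instance Definition _ := Uniform_isComplete.Build subhilbert sub_complete.

Definition subinner (x y : subhilbert) := inner (subval x) (subval y).

Fact subinner_bilinear : bilinear_for
  (GRing.Scale.Law.clone _ _ ( *%R ) _)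
  (GRing.Scale.Law.clone _ _ (@Num.conj R[i] \; *%R ) _) subinner.
Proof.
by split=> [y|x] a u v; [exact: linearPl|exact: linearPr].
Qed.

HB.instance Definition _ :=
  bilinear_isBilinear.Build R[i] _ _ _ _ _ subinner subinner_bilinear.

Fact subinner_herm x y :
  subinner x y = (-1) ^+ false * Num.conj (subinner y x).
Proof. exact: hermC. Qed.

HB.instance Definition _ :=
  isHermitianSesquilinear.Build R[i] _ _ _ subinner subinner_herm.

Fact subinner_gt0 x : x != 0 -> 0 < subinner x x.
Proof. by move=> x0; apply: neq0_dnorm_gt0. Qed.

HB.instance Definition _ := isDotProduct.Build R[i] _ subinner subinner_gt0.

Fact subinner_norm (x : subhilbert) : subinner x x = `|x| ^+ 2.
Proof. exact: inner_norm. Qed.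

HB.instance Definition _ := isHilbert.Build R subhilbert subinner_norm.

End SubHilbert.
Arguments subhilbert {R H} S.

Section Orthocomplement.
Context {R : realType} {H : hilbertType R}.
Implicit Types (x y : H) (A : set H).

Lemma inner_le x y : `|inner x y| <= `|x| * `|y|.
Proof.
have [->|y0] := eqVneq y 0; first by rewrite linear0r !normr0 mulr0.
have ny0 : 0 < `|y| by rewrite normr_gt0.
pose a := inner x y / `|y| ^+ 2; pose u := x - a *: y.
have uy : inner u y = 0.
  rewrite /u linearBl/= linearZl_LR/= inner_norm divfK ?subrr//.
  by rewrite expf_neq0// gt_eqF.
have xE : `|x| ^+ 2 = `|u| ^+ 2 + `|a *: y| ^+ 2.
  rewrite -!inner_norm -hnormDd/=; first by rewrite subrK.
  by rewrite linearZr_LR/= uy mulr0.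
have : `|a *: y| <= `|x|.
  by rewrite -(@ler_pXn2r _ 2)// ?nnegrE// xE lerDr exprn_ge0.
rewrite normrZ normrM normfV normrX normr_id => /(ler_wpM2r (ltW ny0)).
by rewrite -!mulrA -expr2 mulVf ?mulr1// expf_neq0// gt_eqF.
Qed.

Definition orthoset A : set H := [set x | forall a, A a -> inner x a = 0].

Fact ortho0 A : orthoset A 0.
Proof. by move=> a _; rewrite linear0l. Qed.

Fact orthoP A (c : R[i]) x y :
  orthoset A x -> orthoset A y -> orthoset A (c *: x + y).
Proof. by move=> Ax Ay a Aa; rewrite linearPl/= Ax// Ay// mulr0 addr0. Qed.

Fact ortho_closed A : closed (orthoset A).
Proof.
move=> x clx a Aa; apply/eqP/negPn/negP => xa0.
have na : 0 < `|a| + 1 by rewrite ltr_wpDl.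
have e0 : 0 < `|inner x a| / (`|a| + 1) by rewrite divr_gt0 ?normr_gt0.
have [y [Ay]] := clx _ (nbhsx_ballx x _ e0).
rewrite -ball_normE /= ltr_pdivlMr// => /lt_geF.
have <- : inner (x - y) a = inner x a by rewrite linearBl/= (Ay _ Aa) subr0.
by move/negP; apply; apply: (le_trans (inner_le _ _)); rewrite ler_wpM2l// lerDl.
Qed.

Definition orthocomplement A : closed_subspace H :=
  ClosedSubspace (ortho0 (A := A)) (@orthoP A) (@ortho_closed A).

End Orthocomplement.

Section HardySpaces.
Context {R : realType}.
Implicit Types E : hilbertType R.

Definition disc : Type := {z : R[i] | `|z| < 1}.

(* [f] is analytic on the disc with Taylor coefficients [a] at the origin. *)
Definition taylor E (f : disc -> E) (a : nat -> E) : Prop :=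
  forall z, series (fun n => sval z ^+ n *: a n) @ \oo --> f z.

Definition sqr_norms E (a : nat -> E) : nat -> R[i]^o :=
  series (fun n => `|a n| ^+ 2 : R[i]^o).

Definition hardy2 E : set (disc -> E) :=
  [set f | exists a, taylor f a /\ cvgn (sqr_norms a)].

Definition hardy2_sqrnorm E (f : disc -> E) : R[i] :=
  limn (sqr_norms (xget (fun=> 0) (taylor f))).

(* Bounded functions that are complex differentiable on the disc for the
   operator norm, every operator norm bound being written out pointwise. *)
Definition hardy_infty E (Phi : disc -> E -> E) : Prop :=
  [/\ forall z, linear (Phi z),
      exists c : R[i], forall z x, `|Phi z x| <= c * `|x|
    & forall z, exists2 D : E -> E, bounded_operator D &
        forall e : R[i], 0 < e -> exists2 d : R[i], 0 < d &
          forall w : disc, `|sval w - sval z| < d -> forall x,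
            `|Phi w x - Phi z x - (sval w - sval z) *: D x|
              <= e * `|sval w - sval z| * `|x|].

Definition mult_op E (Phi : disc -> E -> E) (f : disc -> E) : disc -> E :=
  fun z => Phi z (f z).

End HardySpaces.
Arguments disc R : clear implicits.

Definition wandering (R : realType) (H : hilbertType R) (V : H -> H) :
    closed_subspace H := orthocomplement (range V).

Notation pair_wandering V1 V2 := (subhilbert (wandering (V1 \o V2))).

Section Pairs.
Context {R : realType} {H : hilbertType R}.

Definition wold_unitary (V : H -> H)
    (Pi : {linear H -> (disc R -> subhilbert (wandering V))}) : Prop :=
  [/\ range Pi = @hardy2 R (subhilbert (wandering V)),
      forall x, hardy2_sqrnorm (Pi x) = `|x| ^+ 2
    & forall m eta z, Pi (iter m V (subval eta)) z = sval z ^+ m *: eta].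

Context (V1 V2 : H -> H).
Local Notation W := (pair_wandering V1 V2).

Definition pure_pair := pure_operator (V1 \o V2).

Definition bcl_pair (Phi1 Phi2 : disc R -> W -> W) :=
  [/\ hardy_infty Phi1, hardy_infty Phi2
    & exists2 Pi, @wold_unitary (V1 \o V2) Pi &
        forall x, Pi (V1 x) = mult_op Phi1 (Pi x) /\
                  Pi (V2 x) = mult_op Phi2 (Pi x)].

Definition wandering1 : set W :=
  [set w | csset (wandering V1) (subval w)].

Definition wandering2 : set W :=
  [set w | csset (wandering V2) (subval w)].

Definition V1_wandering2 : set W :=
  [set w | (V1 @` csset (wandering V2)) (subval w)].

End Pairs.
Arguments wandering1 {R H} V1 V2.
Arguments wandering2 {R H} V1 V2.
Arguments V1_wandering2 {R H} V1 V2.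

Section BlockUnitary.
Context {R : realType} {H : hilbertType R} {V1 V2 : {linear H -> H}}.
Context (iso1 : isometry inner inner V1) (iso2 : isometry inner inner V2).
Context (V12 : forall x, V1 (V2 x) = V2 (V1 x)).

Lemma adjoint_isometryK : cancel V1 (adjoint V1).
Proof.
move=> x; rewrite /adjoint; case: xgetP => [y _ yP|/(_ x)]; last first.
  by case=> u; exact: iso1.
apply/esym/eqP; rewrite -subr_eq0 -normr_eq0 -sqrf_eq0 -inner_norm.
by rewrite linearBr/= -(yP (x - y)) iso1 subrr.
Qed.

Definition block_val (w : pair_wandering V1 V2) : H :=
  V2 (subval (proj (wandering1 V1 V2) w)) +
  adjoint V1 (subval (proj (V1_wandering2 V1 V2) w)).

Fact block_valP w : block_val w \in cspred (wandering (V1 \o V2)).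
Proof.
have pP (A : set (pair_wandering V1 V2)) : A 0 -> A (proj A w).
  by move=> A0; rewrite /proj; case: xgetP => // p _ [].
apply/cspredP; change (orthoset (range (V1 \o V2)) (block_val w)) => _ [u _ <-].
rewrite /block_val linearDl/=.
have p1 : csset (wandering V1) (subval (proj (wandering1 V1 V2) w)).
  by apply: (pP (wandering1 V1 V2)); exact: cs0.
have [w2 w2P <-] : (V1 @` csset (wandering V2))
    (subval (proj (V1_wandering2 V1 V2) w)).
  by apply: (pP (V1_wandering2 V1 V2)); exists 0; [exact: cs0|exact: linear0].
rewrite adjoint_isometryK [in X in X + _]V12 iso2 [in X in _ + X]V12.
rewrite -[RHS]addr0; congr (_ + _); first by apply: p1; exists u.
by apply: w2P; exists (V1 u).
Qed.

(* The block diagonal operator with entries [V2] and [adjoint V1], from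
   W1 (+) V1 W2 to V2 W1 (+) W2; the components of a vector in the first
   decomposition are its orthogonal projections. *)
Definition block_unitary (w : pair_wandering V1 V2) : pair_wandering V1 V2 :=
  SubHilbert (block_valP w).

End BlockUnitary.

(* Main.v *)
Require Import Defs.
From HB Require Import structures.
From mathcomp Require Import all_boot all_order all_algebra sesquilinear.
From mathcomp Require Import complex.
From mathcomp Require Import boolp classical_sets functions reals topology.
From mathcomp Require Import tvs normedtype sequences ring.

Set Implicit Arguments.
Unset Strict Implicit.
Unset Printing Implicit Defensive.

Import Order.TTheory GRing.Theory Num.Theory.
Import numFieldNormedType.Exports.

Local Open Scope ring_scope.

(** Write V for the composite of V1 and V2, and W for its wandering subspace,
    which is the kernel of the adjoint V*.

    The formulas.  Let w lie in W and let P project W onto W2.  Then P w lies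
    in W2 and w - P w lies in V2 W1, and the inverse of U acts on W2 as V1 and
    on V2 W1 as the inverse of V2.  Hence
      V1 w = U* P w + V U* (w - P w),
    and in the same way V2 w = (U w - P U w) + V P U w
    ([V1_decomposition], [V2_decomposition]).  Any Wold unitary Pi sends
    p + V q, with p and q in W, to the function p + z q.  As Pi w is the
    constant function w, the relation Pi V_i = M_Phi_i Pi, evaluated at w,
    says that Phi_i(z) w = Pi (V_i w) (z), which is the announced polynomial of
    degree one in z.

    Existence.  Conversely these two polynomials have to be shown to form the
    BCL pair, so a Wold unitary is needed.  It is the map sending x to the power
    series with coefficients P_W V*^n x ([wold]).  The identity
      |x|^2 = |P_W x|^2 + |V* x|^2
    iterates to: the first n coefficients have total square norm
    |x|^2 - |V*^n x|^2, and this tends to |x|^2 because V is pure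
    ([sqr_norms_wold_coef_cvg]); that the Hardy norm may be computed from these
    coefficients is the uniqueness of Taylor coefficients ([taylor_unique]).
    Surjectivity comes from summing V^n a_n in H ([synthesis_cvg]).  Finally,
    both sides of Pi V_i = M_Phi_i Pi agree on W and are multiplied by z when x
    is replaced by V x, so that their difference d satisfies
    d(x) = z^n d(V*^n x), which tends to 0 ([wold_intertwine]).

    All adjoints at hand are adjoints of isometries.  They exist by a least
    squares argument ([isometry_least_squares]), and from then on an adjoint is
    a linear map A with <V x, y> = <x, A y>. *)

(** * Limits in normed modules *)
Section Limits.
Context {K : numFieldType}.

Lemma cauchy_seq_cvg (E : completeNormedModType K) (u : nat -> E) :
    (forall e : K, 0 < e ->
      exists N, forall n, (N <= n)%N -> `|u N - u n| < e) ->
  cvgn u.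
Proof.
move=> uC; apply: cauchy_cvg; apply: cauchy_exP => e /uC[N uN].
by exists (u N); exists N => // n /= Nn; rewrite -ball_normE /=; exact: uN.
Qed.

(** The bound [c] is real as it dominates a norm; this is what allows the
    comparison by contradiction over a field that is only partially ordered. *)
Lemma norm_limit_le (E : normedModType K) (u : nat -> E) l c :
  (u @ \oo --> l)%classic -> (forall n, `|u n| <= c) -> `|l| <= c.
Proof.
move=> ul uc; have cr : c \is Num.real.
  by rewrite ger0_real// (le_trans _ (uc 0%N)).
rewrite real_leNgt ?normr_real//; apply/negP; rewrite -subr_gt0 => lc.
move/cvgrPdist_lt : ul => /(_ _ lc)[N _ /(_ N (leqnn N))].
have := ler_normD (l - u N) (u N); rewrite subrK ltrBrDr => h1 h2.
by have := le_lt_trans (le_trans h1 (lerD (lexx _) (uc N))) h2; rewrite ltxx.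
Qed.

Lemma norm_le_cvg0 (E F : normedModType K) (x : E) (b : nat -> F) (c : K) :
  (b @ \oo --> (0 : F))%classic -> (forall n, `|x| <= c * `|b n|) -> x = 0.
Proof.
move=> /cvgr0Pnorm_lt b0 xb; apply/eqP; rewrite -normr_le0.
rewrite real_leNgt ?normr_real ?real0//; apply/negP => x0.
have c0 : 0 < c.
  have := lt_le_trans x0 (xb 0%N).
  have := normr_ge0 (b 0%N); rewrite le_eqVlt => /predU1P[<-|b00].
    by rewrite mulr0 ltxx.
  by rewrite pmulr_lgt0.
have [N _ /(_ N (leqnn N))] := b0 _ (divr_gt0 x0 c0).
rewrite ltr_pdivlMr// mulrC => h.
by have := le_lt_trans (xb N) h; rewrite ltxx.
Qed.

Lemma lipschitz_linear_continuous (E F : normedModType K)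
    (f : {linear E -> F}) (c : K) :
  (forall x, `|f x| <= c * `|x|) -> continuous f.
Proof.
move=> fc; apply/bounded_linear_continuous/bounded_funP => r.
have c0 : 0 <= `|c| by [].
exists (`|c| * `|r|) => x xr.
have r0 : 0 <= r by exact: le_trans xr.
have [->|x0] := eqVneq x 0; first by rewrite linear0 normr0 mulr_ge0.
have cx : 0 <= c * `|x| by exact: le_trans (fc x).
have cr : 0 <= c by rewrite pmulr_lge0 ?normr_gt0// in cx.
rewrite !ger0_norm//; apply: le_trans (fc x) _; exact: ler_wpM2l.
Qed.

End Limits.

(** * Adjoints of isometries *)
Section HilbertAdjoint.
Local Open Scope complex_scope.
Local Open Scope classical_set_scope.
Context {R : realType}.
Implicit Types E F : hilbertType R.

Lemma inner_conj E (x y : E) : inner x y = Num.conj (inner y x).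
Proof. by rewrite hermC expr0 mul1r. Qed.

Lemma inner_ext E (x y : E) : (forall u, inner u x = inner u y) -> x = y.
Proof.
move=> xy; apply/eqP; rewrite -subr_eq0 -normr_eq0 -sqrf_eq0 -inner_norm.
by rewrite linearBr/= xy subrr.
Qed.

Lemma normD_sqr E (x y : E) :
  inner x y = 0 -> `|x + y| ^+ 2 = `|x| ^+ 2 + `|y| ^+ 2.
Proof. by move=> xy; rewrite -!inner_norm hnormDd. Qed.

Lemma inner_isometry E F (T : E -> F) x y :
  isometry inner inner T -> inner (T x) (T y) = inner x y.
Proof. exact. Qed.

Lemma norm_isometry E F (T : E -> F) x :
  isometry inner inner T -> `|T x| = `|x|.
Proof.
move=> iT; apply/eqP; rewrite -(@eqrXn2 _ 2)//.
by rewrite -!inner_norm (inner_isometry _ _ iT).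
Qed.

Lemma real_complex_ge0 (r : R) : (0 <= r%:C) = (0 <= r).
Proof. exact: (lecR 0 r). Qed.

Lemma gt0_real_complex (e : R[i]) : 0 < e -> exists2 r : R, 0 < r & e = r%:C.
Proof.
move=> e0; have er : e \is Num.real by exact: gtr0_real.
by exists (complex.Re e); [rewrite -ltcR RRe_real | rewrite RRe_real].
Qed.

(** If [u] minimizes [`|y - V u| ^+ 2] up to [e ^+ 2], then [y - V u] is
    orthogonal to the range of [V] up to [e]: its component along [V a] could
    otherwise be removed, lowering the distance by too much. *)
Lemma approx_projection E F (V : {linear E -> F}) (y : F) (e : R) :
    isometry inner inner V -> 0 < e ->
  exists u, forall a, `|inner (y - V u) (V a)| <= e%:C * `|a|.
Proof.
move=> iV e0.
pose N (x : F) : R := complex.Re (`|x| ^+ 2).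
have NE x : (N x)%:C = `|x| ^+ 2 by rewrite RRe_real// realX// normr_real.
pose D := [set N (y - V u) | u in [set: E]].
have Dinf : has_inf D.
  split; first by exists (N (y - V 0)); exists 0.
  by exists 0 => _ [u _ <-]; rewrite -lecR NE exprn_ge0.
have e20 : 0 < e ^+ 2 by rewrite exprn_gt0.
have [_ [u _ <-] ltu] := inf_adherent e20 Dinf.
exists u => a; set r := y - V u.
have [->|a0] := eqVneq a 0; first by rewrite linear0 linear0r !normr0 mulr0.
have na : 0 < `|a| by rewrite normr_gt0.
(* [t *: V a] is the component of [r] along [V a]; subtracting it from [r]
   lowers the squared norm by its own squared norm, hence by at most
   [e ^+ 2]. *)
pose t := inner r (V a) / `|a| ^+ 2.
have rE : `|r| ^+ 2 = `|r - t *: V a| ^+ 2 + `|t *: V a| ^+ 2.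
  rewrite -normD_sqr ?subrK// linearZr_LR/= linearBl/= linearZl_LR/=.
  rewrite (inner_isometry _ _ iV) inner_norm divfK ?subrr ?mulr0//.
  by rewrite expf_neq0// gt_eqF.
have le_r : `|r| ^+ 2 <= `|r - t *: V a| ^+ 2 + e%:C ^+ 2.
  rewrite -rmorphXn/= -!NE -rmorphD lecR (le_trans (ltW ltu))// lerD2r.
  apply: ge_inf; first by case: Dinf.
  by exists (u + t *: a) => //; rewrite linearD linearZ/= opprD addrA.
move: le_r; rewrite {1}rE lerD2l ler_pXn2r ?nnegrE//; last first.
  by rewrite real_complex_ge0 ltW.
rewrite normrZ (norm_isometry _ iV) /t normrM normfV normrX normr_id.
move=> /(ler_wpM2r (ltW na)).
by rewrite -!mulrA -expr2 mulVf ?mulr1// expf_neq0// gt_eqF.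
Qed.

(** The projection theorem for the range of an isometry.  Near-orthogonality
    does the work twice: it makes the near-minimizers a Cauchy sequence, without
    the parallelogram law, and it passes to the limit as orthogonality.
    Minimizing over the domain of [V] also avoids proving the range closed. *)
Lemma isometry_least_squares E F (V : {linear E -> F}) (y : F) :
    isometry inner inner V ->
  exists u, forall a, inner (y - V u) (V a) = 0.
Proof.
move=> iV; pose h n : R := harmonic n.
have h0 n : 0 < h n by rewrite /h /=; exact: harmonic_gt0.
have /choice[u uP] : forall n, exists u, forall a,
    `|inner (y - V u) (V a)| <= (h n)%:C * `|a|.
  by move=> n; exact: approx_projection.
have small (e : R[i]) : 0 < e -> \forall n \near \oo, (h n)%:C < e.
  move=> /gt0_real_complex[r r0 ->].
  have /cvgr0Pnorm_lt/(_ _ r0) := @cvg_harmonic R.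
  by apply: filterS => n; rewrite ltcR ger0_norm// ltW.
have du m n : `|u m - u n| <= (h m)%:C + (h n)%:C.
  set a := u m - u n.
  have [->|a0] := eqVneq a 0.
    by rewrite normr0 addr_ge0// real_complex_ge0 ltW.
  have na : 0 < `|a| by rewrite normr_gt0.
  rewrite -(ler_pM2r na) -expr2 -inner_norm -(inner_isometry _ _ iV).
  (* [V a] is the difference of two residuals, each almost orthogonal to it. *)
  have -> : inner (V a) (V a) =
      inner (y - V (u n)) (V a) - inner (y - V (u m)) (V a).
    by rewrite -linearBl/= opprB addrC subrKA -linearB.
  have aR : 0 <= inner (V a) (V a) by rewrite inner_norm exprn_ge0.
  rewrite -[leLHS]ger0_norm.
    by rewrite (le_trans (ler_normB _ _))// mulrDl [leLHS]addrC lerD.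
  by rewrite -linearBl/= opprB addrC subrKA -linearB.
have /cvg_ex[l ul] : cvgn u.
  apply: cauchy_seq_cvg => e e0.
  have e20 : 0 < e / 2 by rewrite divr_gt0.
  have [N _ NP] := small _ e20; exists N => n Nn.
  rewrite (le_lt_trans (du _ _))// (splitr e) ltrD//; last exact: NP.
  exact: (NP N (leqnn N)).
exists l => a; apply/eqP; rewrite -normr_le0.
rewrite real_leNgt ?normr_real ?real0//; apply/negP => c0.
set c := `|_| in c0.
have na : 0 < `|a| + 1 by rewrite ltr_wpDl.
pose e := c / (`|a| + 1) / 2.
have e0 : 0 < e by rewrite !divr_gt0.
move/cvgrPdist_lt : ul => /(_ _ e0) ul.
have [N _ /(_ N (leqnn N))[/= hN uN]] := filterI (small _ e0) ul.
have : c <= `|l - u N| * `|a| + (h N)%:C * `|a|.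
  rewrite /c; have -> : y - V l = V (u N - l) + (y - V (u N)).
    by rewrite linearB/= [RHS]addrC subrKA.
  rewrite linearDl/= (le_trans (ler_normD _ _))// lerD//.
  by rewrite (inner_isometry _ _ iV) distrC inner_le.
rewrite -mulrDl => cle.
have : c < (e + e) * (`|a| + 1).
  apply: (le_lt_trans cle); apply: (@le_lt_trans _ _ ((e + e) * `|a|)).
    by rewrite ler_wpM2r// lerD// ltW.
  by rewrite ltr_pM2l ?addr_gt0// ltrDl.
by rewrite -splitr divfK ?ltxx// gt_eqF.
Qed.

Section AdjointIsometry.
Context {E F : hilbertType R} {V : {linear E -> F}}.
Hypothesis iV : isometry inner inner V.

Lemma inner_adjoint x y : inner (V x) y = inner x (adjoint V y).
Proof.
rewrite /adjoint; case: xgetP => [u _ uP//|].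
have [u uP] := isometry_least_squares y iV.
move=> /(_ u)[] v; rewrite -[y](subrK (V u)) linearDr/= (inner_isometry _ _ iV).
by rewrite inner_conj uP rmorph0 add0r.
Qed.

Lemma adjoint_linear : linear (adjoint V).
Proof.
move=> a x y; apply: inner_ext => u.
rewrite -inner_adjoint [RHS]linearDr/= linearDr/= !linearZr_LR/=.
by rewrite -!inner_adjoint.
Qed.

(** The adjoint with its linearity bundled, so that the rewriting rules for
    linear maps apply to it. *)
Lemma exists_linear_adjoint :
  exists A : {linear F -> E}, forall x y, inner (V x) y = inner x (A y).
Proof.
pose L := GRing.isLinear.Build R[i] F E *:%R (adjoint V) adjoint_linear.
pose A : {linear F -> E} := HB.pack (adjoint V) L.
by exists A => x y; exact: inner_adjoint.
Qed.

End AdjointIsometry.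

End HilbertAdjoint.

(** * Operators on Hilbert spaces *)
Section Operators.
Local Open Scope complex_scope.
Local Open Scope classical_set_scope.
Context {R : realType}.
Implicit Types E F : hilbertType R.

Lemma adjoint_unique E F (T : E -> F) (S : F -> E) :
  (forall x y, inner (T x) y = inner x (S y)) -> adjoint T = S.
Proof.
move=> TS; apply/funext => y; apply: xget_unique => [u|v vP]; first exact: TS.
by apply: inner_ext => u; rewrite -vP TS.
Qed.

(** Two candidates [p] and [q] differ by an element of [S] that is orthogonal
    to [S]. *)
Lemma proj_unique E (S : set E) x p :
    (forall a b, S a -> S b -> S (a - b)) -> S p ->
    (forall a, S a -> inner (x - p) a = 0) ->
  proj S x = p.
Proof.
move=> SB Sp xp; apply: xget_unique => // q [Sq xq].
apply/eqP; rewrite -subr_eq0 -normr_eq0 -sqrf_eq0 -inner_norm.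
rewrite -[X in inner X _](_ : (x - p) - (x - q) = q - p).
  have Sqp : S (q - p) by exact: SB.
  by rewrite linearBl/= xp// xq// subrr.
by rewrite opprB addrC subrKA.
Qed.

Lemma contraction_bounded_operator E F (T : E -> F) :
  linear T -> (forall x, `|T x| <= `|x|) -> bounded_operator T.
Proof.
move=> lT Tc; split=> //.
pose L := GRing.isLinear.Build R[i] E F *:%R T lT.
pose f : {linear E -> F} := HB.pack T L.
have fc x : `|f x| <= 1 * `|x| by rewrite mul1r; exact: Tc.
exact: lipschitz_linear_continuous fc.
Qed.

(** The derivative of such a function is the constant [b], with difference
    quotient equal to it. *)
Lemma affine_hardy_infty E (a b : E -> E) :
    linear a -> linear b ->
    (forall x, `|a x| <= `|x|) -> (forall x, `|b x| <= `|x|) ->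
  hardy_infty (fun (z : disc R) x => a x + sval z *: b x).
Proof.
move=> la lb ac bc; split.
- move=> z k x y; rewrite la lb !scalerDr addrACA; congr (_ + _ + _).
  by rewrite !scalerA mulrC.
- exists 2 => z x; rewrite mulr_natl mulr2n (le_trans (ler_normD _ _))//.
  rewrite lerD// normrZ (le_trans _ (bc x))// ler_piMl// ltW//.
  exact: (svalP z).
- move=> z; exists b; first exact: contraction_bounded_operator.
  move=> e e0; exists 1 => // w _ x.
  rewrite opprD addrACA subrr add0r -scalerBl subrr normr0.
  by rewrite !mulr_ge0// ltW.
Qed.

End Operators.

(** * Uniqueness of Taylor coefficients *)
Section Taylor.
Local Open Scope complex_scope.
Local Open Scope classical_set_scope.
Context {R : realType} {E : hilbertType R}.
Implicit Types (a b c : nat -> E) (z : R[i]).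

Definition power_series z c : nat -> E := series (fun n => z ^+ n *: c n).

Lemma power_series0 z c : power_series z c 0 = 0.
Proof. by rewrite /power_series /series /= big_geq. Qed.

Lemma power_seriesS z c n :
  power_series z c n.+1 = c 0%N + z *: power_series z (fun k => c k.+1) n.
Proof.
rewrite /power_series /series /= big_nat_recl//= expr0 scale1r; congr (_ + _).
by rewrite scaler_sumr; apply: eq_bigr => k _; rewrite scalerA -exprS.
Qed.

(** The terms are at most [M / 2 ^+ k]; the proof carries the exact geometric
    remainder through the induction. *)
Lemma norm_power_series_le z c (M : R[i]) n :
    (forall k, `|c k| <= 2 ^+ k * M) -> `|z| <= 4^-1 ->
  `|power_series z c n| <= 2 * M.
Proof.
move=> cM z4; have M0 : 0 <= M.
  by have := le_trans (normr_ge0 _) (cM 0%N); rewrite expr0 mul1r.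
suff : `|power_series z c n| <= 2 * M - 2 * M * 2^-1 ^+ n.
  move/le_trans; apply; rewrite gerDl oppr_le0 mulr_ge0 ?mulr_ge0//.
  by rewrite exprn_ge0// invr_ge0.
elim: n => [|n IH].
  by rewrite power_series0 normr0 expr0 mulr1 subrr.
have -> : power_series z c n.+1 = power_series z c n + z ^+ n *: c n.
  exact: seriesSr.
rewrite (le_trans (ler_normD _ _))// (le_trans (lerD IH (lexx _)))//.
have : `|z ^+ n *: c n| <= M * 2^-1 ^+ n.
  rewrite normrZ normrX (@le_trans _ _ (4^-1 ^+ n * (2 ^+ n * M)))//.
    by rewrite ler_pM ?exprn_ge0// lerXn2r ?nnegrE ?invr_ge0.
  rewrite mulrA -exprMn mulrC ler_wpM2l//.
  suff -> : 4^-1 * 2 = 2^-1 :> R[i] by [].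
  by rewrite (natrM _ 2 2) invfM mulfVK ?pnatr_eq0.
move=> h; rewrite (le_trans (lerD (lexx _) h))// exprS.
have -> : 2 * M * (2^-1 * 2^-1 ^+ n) = M * 2^-1 ^+ n.
  by rewrite mulrA [2 * M]mulrC mulfK ?pnatr_eq0.
by rewrite -addrA lerD2l -mulrA mulr_natl mulr2n opprD subrK.
Qed.

(** Convergence at [1/2] bounds [c k] by [2 ^+ k * M'], hence the part of the
    series after [c 0] by [4 * M' * `|z|] for small [z]; so [`|c 0|] is at most
    that.  Excluding [z = 0] from the hypothesis makes it stable under the
    shift of coefficients. *)
Lemma power_series_coef0 c :
    (forall z, z != 0 -> `|z| < 1 -> power_series z c @ \oo --> (0 : E)) ->
  c 0%N = 0.
Proof.
move=> c0; apply/eqP/negPn/negP => nc0.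
have h2 : `|2^-1 : R[i]| < 1 by rewrite ger0_norm ?invr_ge0// invf_lt1// ltr1n.
have /cvg_series_cvg_0/cvgP/cvg_seq_bounded : cvgn (power_series 2^-1 c).
  by apply: cvgP; apply: c0 => //; rewrite invr_eq0 pnatr_eq0.
move=> [L [_ /(_ (L + 1))]]; rewrite ltrDl ltr01 => /(_ isT).
set M' := L + 1 => cM'.
have cM k : `|c k| <= 2 ^+ k * M'.
  have := cM' k I; rewrite /= normrZ normrX ger0_norm ?invr_ge0// exprVn.
  by rewrite ler_pdivrMl// exprn_gt0.
have M0 : 0 < M'.
  have := cM 0%N; rewrite expr0 mul1r; apply: lt_le_trans.
  by rewrite normr_gt0.
(* At this point the bound [4 * M' * z] is half of [`|c 0|]. *)
pose z : R[i] := `|c 0%N| / (8 * M').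
have z0 : 0 < z by rewrite divr_gt0 ?mulr_gt0// normr_gt0.
have z8 : z <= 8^-1.
  rewrite /z invfM mulrA mulrAC -[leRHS]mul1r.
  apply: ler_wpM2r; first by rewrite invr_ge0.
  by rewrite ler_pdivrMr// -(expr0 2); exact: cM.
have z4 : `|z| <= 4^-1.
  by rewrite ger0_norm ?(ltW z0)// (le_trans z8)// lef_pV2 ?posrE// ler_nat.
have z1 : `|z| < 1 by rewrite (le_lt_trans z4)// invf_lt1// ltr1n.
have := c0 z (lt0r_neq0 z0) z1; rewrite -cvg_shiftS => cz.
have : `|c 0%N - 0| <= z * (2 * (2 * M')).
  apply: (@norm_limit_le _ _ (fun n => c 0%N - power_series z c n.+1)).
    by apply: cvgB => //; exact: cvg_cst.
  move=> n; rewrite power_seriesS opprD addNKr normrN normrZ.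
  rewrite (ger0_norm (ltW z0)) ler_wpM2l ?(ltW z0)//.
  apply: norm_power_series_le => // k.
  by rewrite (le_trans (cM _))// exprS mulrA [2 * _]mulrC.
have -> : z * (2 * (2 * M')) = `|c 0%N| / 2.
  by rewrite /z; field; rewrite lt0r_neq0.
rewrite subr0 ler_pdivlMr// ger_pMr ?normr_gt0//.
by rewrite (ler_nat _ 2 1).
Qed.

Lemma power_series_eq0 c :
    (forall z, z != 0 -> `|z| < 1 -> power_series z c @ \oo --> (0 : E)) ->
  forall n, c n = 0.
Proof.
move=> cz n; elim: n c cz => [|n IH] c cz; first exact: power_series_coef0.
apply: (IH (fun k => c k.+1)) => z z0 z1.
have -> : power_series z (fun k => c k.+1) =
    (fun n => z^-1 *: power_series z c n.+1).
  apply/funext => k; rewrite power_seriesS power_series_coef0// add0r.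
  by rewrite scalerA mulVf// scale1r.
rewrite -(scaler0 _ z^-1); apply: cvgZl_tmp.
by rewrite cvg_shiftS; exact: cz.
Qed.

Lemma taylor_unique (f : disc R -> E) a b : taylor f a -> taylor f b -> a = b.
Proof.
move=> fa fb; apply/funext => n; apply/eqP; rewrite -subr_eq0; apply/eqP.
move: n; apply: power_series_eq0 => z _ z1.
have -> : power_series z (fun n => a n - b n) =
    (fun n => power_series z a n - power_series z b n).
  apply/funext => k; rewrite /power_series /series /= -sumrB.
  by apply: eq_bigr => i _; rewrite scalerBr.
rewrite -(subrr (f (exist _ z z1))); apply: cvgB.
- exact: (fa (exist _ z z1)).
- exact: (fb (exist _ z z1)).
Qed.

Lemma hardy2_sqrnormE (f : disc R -> E) a :
  taylor f a -> hardy2_sqrnorm f = limn (sqr_norms a).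
Proof.
move=> fa; rewrite /hardy2_sqrnorm; congr (limn (sqr_norms _)).
by apply: xget_unique => // b fb; exact: taylor_unique fb fa.
Qed.

End Taylor.

(** * The Wold decomposition of an isometry *)
Section Wold.
Local Open Scope complex_scope.
Local Open Scope classical_set_scope.
Context {R : realType} {H : hilbertType R} {V A : {linear H -> H}}.
Hypothesis iV : isometry inner inner V.
Hypothesis VA : forall x y, inner (V x) y = inner x (A y).
Local Notation W := (subhilbert (wandering V)).

Lemma isometryK x : A (V x) = x.
Proof. by apply: inner_ext => u; rewrite -VA (inner_isometry _ _ iV). Qed.

Lemma wanderingE x : csset (wandering V) x <-> A x = 0.
Proof.
split=> [Wx|Ax u [v _ <-]].
  by apply: inner_ext => u; rewrite linear0r -VA inner_conj Wx ?rmorph0.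
by rewrite inner_conj VA Ax linear0r rmorph0.
Qed.

Lemma coisometry_wandering (w : W) : A (subval w) = 0.
Proof. by apply/wanderingE/cspredP/subvalP. Qed.

Fact wandering_projP x : x - V (A x) \in cspred (wandering V).
Proof. by apply/cspredP/wanderingE; rewrite linearB/= isometryK subrr. Qed.

Definition wandering_proj x : W := SubHilbert (wandering_projP x).

Lemma wandering_proj_linear : linear wandering_proj.
Proof.
move=> a x y; apply: val_inj => /=.
by rewrite !linearP/= scalerBr -!addrA; congr (_ + _); rewrite addrCA scalerN.
Qed.

Lemma wandering_proj_sub (w : W) : wandering_proj (subval w) = w.
Proof.
by apply: val_inj; rewrite /= coisometry_wandering linear0 subr0.
Qed.

Lemma wandering_proj_shift x : wandering_proj (V x) = 0.
Proof. by apply: val_inj; rewrite /= isometryK subrr. Qed.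

(** The range of [V] and the wandering subspace are orthogonal, and
    [`|V (A x)| = `|A x|]. *)
Lemma wandering_pythagoras x :
  `|x| ^+ 2 = `|wandering_proj x| ^+ 2 + `|A x| ^+ 2.
Proof.
rewrite -(norm_isometry _ iV) -[`|wandering_proj x|]/(`|x - V (A x)|).
rewrite -normD_sqr ?subrK//.
by rewrite inner_conj VA linearB/= isometryK subrr linear0r rmorph0.
Qed.

Lemma norm_coisometry x : `|A x| <= `|x|.
Proof.
rewrite -(@ler_pXn2r _ 2)// ?nnegrE// [leRHS]wandering_pythagoras.
by rewrite lerDr exprn_ge0.
Qed.

Lemma norm_wandering_proj x : `|wandering_proj x| <= `|x|.
Proof.
rewrite -(@ler_pXn2r _ 2)// ?nnegrE// [leRHS]wandering_pythagoras.
by rewrite lerDl exprn_ge0.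
Qed.

Definition wold_coef x n : W := wandering_proj (iter n A x).

Definition wold_sum (z : R[i]) x : nat -> W := power_series z (wold_coef x).

Lemma wold_sum0 z x : wold_sum z x 0 = 0.
Proof. exact: power_series0. Qed.

Lemma wold_sumS z x n :
  wold_sum z x n.+1 = wandering_proj x + z *: wold_sum z (A x) n.
Proof.
rewrite /wold_sum power_seriesS; congr (_ + _ *: power_series _ _ _).
by apply/funext => k; rewrite /wold_coef iterSr.
Qed.

Lemma wold_sum_linear z n a x y :
  wold_sum z (a *: x + y) n = a *: wold_sum z x n + wold_sum z y n.
Proof.
elim: n x y => [|n IH] x y; first by rewrite !wold_sum0 scaler0 addr0.
rewrite !wold_sumS wandering_proj_linear linearP IH !scalerDr addrACA.
by rewrite !scalerA mulrC.
Qed.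

(** The Cauchy criterion in disguise: for a pure [V] the vector [iter m A x] is
    small, so the remainders of the series are controlled by purity instead of
    by a geometric series. *)
Lemma wold_sum_tail z x m k :
  wold_sum z x (m + k) - wold_sum z x m = z ^+ m *: wold_sum z (iter m A x) k.
Proof.
elim: m x => [|m IH] x; first by rewrite wold_sum0 subr0 scale1r.
rewrite addSn !wold_sumS iterSr exprS -scalerA -IH.
by rewrite opprD addrACA subrr add0r scalerBr.
Qed.

(** The bound [B = (1 - `|z|)^-1] solves [B = 1 + `|z| * B], which is what the
    recursion [wold_sumS] requires. *)
Lemma norm_wold_sum z x n :
  `|z| < 1 -> `|wold_sum z x n| <= (1 - `|z|)^-1 * `|x|.
Proof.
move=> z1; have z0 : 0 < 1 - `|z| by rewrite subr_gt0.
elim: n x => [|n IH] x.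
  by rewrite wold_sum0 normr0 mulr_ge0// invr_ge0 ltW.
rewrite wold_sumS (le_trans (ler_normD _ _))// normrZ.
have -> : (1 - `|z|)^-1 * `|x| = `|x| + `|z| * ((1 - `|z|)^-1 * `|x|).
  apply: (mulfI (negbT (gt_eqF z0))); rewrite mulrDr mulVKf ?gt_eqF//.
  by rewrite [X in _ = _ + X]mulrCA mulVKf ?gt_eqF// mulrBl mul1r subrK.
rewrite lerD ?norm_wandering_proj// ler_wpM2l// (le_trans (IH _))//.
by rewrite ler_wpM2l ?norm_coisometry// invr_ge0 ltW.
Qed.

(** [wandering_pythagoras], telescoped along the orbit of [x] under [A]. *)
Lemma sqr_norms_wold_coef x n :
  sqr_norms (wold_coef x) n = `|x| ^+ 2 - `|iter n A x| ^+ 2.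
Proof.
elim: n => [|n IH]; first by rewrite /sqr_norms /series /= big_geq// subrr.
have -> : sqr_norms (wold_coef x) n.+1 =
    sqr_norms (wold_coef x) n + `|wold_coef x n| ^+ 2 by exact: seriesSr.
by rewrite IH [in X in _ - X + _]wandering_pythagoras opprD addrA addrAC subrK.
Qed.

(** The partial sums of the inverse of the Wold map: the coefficient sequence
    [a] is sent to the sum of the [V ^ n (a n)]. *)
Definition synthesis (a : nat -> W) : nat -> H :=
  series (fun n => iter n V (subval (a n))).

Lemma norm_synthesis a n : `|synthesis a n| ^+ 2 = sqr_norms a n.
Proof.
rewrite /synthesis /sqr_norms /series /=; elim: n a => [|n IH] a.
  by rewrite !big_geq// normr0 expr0n.
rewrite !big_nat_recl//= -(IH (fun k => a k.+1)) -raddf_sum /=.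
rewrite normD_sqr ?(norm_isometry _ iV)//.
by rewrite inner_conj VA coisometry_wandering linear0r rmorph0.
Qed.

(** [norm_synthesis], applied to [a] with its first [m] terms erased. *)
Lemma norm_synthesis_tail a m n : (m <= n)%N ->
  `|synthesis a n - synthesis a m| ^+ 2 = sqr_norms a n - sqr_norms a m.
Proof.
move=> mn; pose b k := if (k < m)%N then 0 else a k.
have : `|synthesis b n| ^+ 2 = sqr_norms b n := norm_synthesis b n.
have iter0 k : iter k V 0 = 0 by elim: k => //= k ->; rewrite linear0.
have -> : synthesis b n = synthesis a n - synthesis a m.
  rewrite /synthesis /series /= (big_cat_nat (n := m))//=.
  rewrite [in RHS](big_cat_nat (n := m))//= [RHS]addrC addKr.
  rewrite big1_seq ?add0r => [|k]; last first.
    by rewrite mem_index_iota /b => /andP[_ /andP[_ ->]]; rewrite iter0.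
  by apply: eq_big_nat => k /andP[mk _]; rewrite /b ltnNge mk.
move=> ->; rewrite /sqr_norms /series /= (big_cat_nat (n := m))//=.
rewrite [in RHS](big_cat_nat (n := m))//= [RHS]addrC addKr.
rewrite big1_seq ?add0r => [|k]; last first.
  by rewrite mem_index_iota /b => /andP[_ /andP[_ ->]]; rewrite normr0 expr0n.
by apply: eq_big_nat => k /andP[mk _]; rewrite /b ltnNge mk.
Qed.

Lemma synthesis_cvg a : cvgn (sqr_norms a) -> cvgn (synthesis a).
Proof.
move=> /cvg_cauchy/cauchyP aC; apply: cauchy_seq_cvg => e e0.
have [c [N _ cN]] := aC _ (divr_gt0 (exprn_gt0 2 e0) (ltr0n _ 2)).
exists N => n Nn; rewrite -(@ltr_pXn2r _ 2)// ?nnegrE ?(ltW e0)//.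
rewrite distrC norm_synthesis_tail//.
have N1 := cN N (leqnn N); have N2 := cN n Nn.
rewrite -ball_normE /= in N1 N2.
have -> : sqr_norms a n - sqr_norms a N =
    `|sqr_norms a n - sqr_norms a N|.
  by rewrite ger0_norm// -norm_synthesis_tail// exprn_ge0.
by rewrite (le_lt_trans (ler_distD c _ _))// (splitr (e ^+ 2)) ltrD// distrC.
Qed.

End Wold.

(** * The Wold map of a pure isometry *)
Section WoldMap.
Local Open Scope complex_scope.
Local Open Scope classical_set_scope.
Context {R : realType} {H : hilbertType R} {V A : {linear H -> H}}.
Hypothesis iV : isometry inner inner V.
Hypothesis VA : forall x y, inner (V x) y = inner x (A y).
Hypothesis A0 : forall x, (fun n => iter n A x) @ \oo --> (0 : H).
Local Notation W := (subhilbert (wandering V)).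
Local Notation proj0 := (wandering_proj iV VA).
Local Notation wsum := (wold_sum iV VA).

Lemma wold_sum_cvg z x : `|z| < 1 -> cvgn (wsum z x).
Proof.
move=> z1; have z0 : 0 < 1 - `|z| by rewrite subr_gt0.
apply: cauchy_seq_cvg => e e0.
have /cvgr0Pnorm_lt/(_ _ (mulr_gt0 z0 e0))[N _ /(_ N (leqnn N)) AN] := A0 x.
exists N => n Nn; rewrite distrC -(subnKC Nn) wold_sum_tail normrZ normrX.
rewrite (@le_lt_trans _ _ `|wsum z (iter N A x) (n - N)|)//.
  by rewrite ler_piMl// exprn_ile1// ltW.
by rewrite (le_lt_trans (norm_wold_sum _ _ _ _ z1))// ltr_pdivrMl.
Qed.

Definition wold x (z : disc R) : W := limn (wsum (sval z) x).

Lemma wold_taylor x : taylor (wold x) (wold_coef iV VA x).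
Proof. by move=> z; apply: wold_sum_cvg; exact: (svalP z). Qed.

Lemma wold_eq x z l : wsum (sval z) x @ \oo --> l -> wold x z = l.
Proof. by move=> /cvg_lim; apply; exact: norm_hausdorff. Qed.

Lemma wold_linear z a x y : wold (a *: x + y) z = a *: wold x z + wold y z.
Proof.
apply: wold_eq.
have -> : wsum (sval z) (a *: x + y) =
    (fun n => a *: wsum (sval z) x n + wsum (sval z) y n).
  by apply/funext => n; rewrite wold_sum_linear.
by apply: cvgD; [apply: cvgZl_tmp|]; exact: wold_taylor.
Qed.

Lemma norm_wold z x : `|wold x z| <= (1 - `|sval z|)^-1 * `|x|.
Proof.
apply: (norm_limit_le (@wold_taylor x z)) => n.
exact: norm_wold_sum (svalP z).
Qed.

(** All algebraic properties of the Wold map follow from this equation: [A]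
    undoes [V] and vanishes on the wandering subspace. *)
Lemma wold_rec z x : wold x z = proj0 x + sval z *: wold (A x) z.
Proof.
apply: wold_eq; rewrite -cvg_shiftS.
have -> : (fun n => wsum (sval z) x n.+1) =
    (fun n => proj0 x + sval z *: wsum (sval z) (A x) n).
  by apply/funext => n; rewrite wold_sumS.
by apply: cvgD; [exact: cvg_cst|apply: cvgZl_tmp; exact: wold_taylor].
Qed.

Lemma wold_shift z x : wold (V x) z = sval z *: wold x z.
Proof. by rewrite wold_rec wandering_proj_shift add0r (isometryK iV VA). Qed.

Lemma wold_wandering z (w : W) : wold (subval w) z = w.
Proof.
rewrite wold_rec wandering_proj_sub (coisometry_wandering VA).
have -> : wold 0 z = 0.
  by apply/eqP; rewrite -normr_le0 (le_trans (norm_wold _ _))// normr0 mulr0.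
by rewrite scaler0 addr0.
Qed.

Lemma wold_monomial m (w : W) z :
  wold (iter m V (subval w)) z = sval z ^+ m *: w.
Proof.
elim: m => [|m IH]; first by rewrite wold_wandering expr0 scale1r.
by rewrite iterS wold_shift IH scalerA -exprS.
Qed.

Lemma sqr_norms_wold_coef_cvg x :
  sqr_norms (wold_coef iV VA x) @ \oo --> (`|x| ^+ 2 : R[i]^o).
Proof.
have -> : sqr_norms (wold_coef iV VA x) =
    (fun n => `|x| ^+ 2 - `|iter n A x| * `|iter n A x| : R[i]^o).
  by apply/funext => n; rewrite sqr_norms_wold_coef// expr2.
rewrite -[X in _ --> X]subr0; apply: cvgB; first exact: cvg_cst.
have An : `|iter n A x| @[n --> \oo] --> (0 : R[i]^o).
  by have := cvg_norm (A0 x); rewrite normr0; apply.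
by rewrite -(mulr0 (0 : R[i]^o)); apply: cvgM.
Qed.

Lemma wold_hardy2 x : hardy2 (wold x).
Proof.
exists (wold_coef iV VA x); split; first exact: wold_taylor.
by apply: cvgP; exact: sqr_norms_wold_coef_cvg.
Qed.

Lemma wold_sqrnorm x : hardy2_sqrnorm (wold x) = `|x| ^+ 2.
Proof.
rewrite (hardy2_sqrnormE (@wold_taylor x)).
apply: (@cvg_lim R[i]^o); first exact: norm_hausdorff.
exact: sqr_norms_wold_coef_cvg.
Qed.

Lemma wold_linear_exists :
  exists Pi : {linear H -> (disc R -> W)}, (Pi : H -> disc R -> W) = wold.
Proof.
have lin : linear wold.
  by move=> a x y; apply/funext => z; rewrite wold_linear.
pose L := GRing.isLinear.Build R[i] H (disc R -> W) *:%R wold lin.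
pose Pi : {linear H -> (disc R -> W)} := HB.pack wold L.
by exists Pi.
Qed.

(** The Wold map followed by evaluation at [z] is continuous, and it sends the
    partial sums of [synthesis] to those of the Taylor series of [f]. *)
Lemma wold_surjective f : hardy2 f -> exists x, wold x = f.
Proof.
move=> [a [fa /(synthesis_cvg iV VA)/cvg_ex[x xl]]]; exists x.
have [Pi PiE] := wold_linear_exists.
apply/funext => z.
have wa n : wold (synthesis a n) z = power_series (sval z) a n.
  rewrite -PiE /synthesis /series /= linear_sum fct_sumE.
  by apply: eq_bigr => k _; rewrite -wold_monomial -PiE.
have wx : (fun n => wold (synthesis a n) z) @ \oo --> wold x z.
  apply/cvgrPdist_lt => e e0.
  have z0 : 0 < 1 - `|sval z| by rewrite subr_gt0; exact: (svalP z).
  have /cvgrPdist_lt/(_ _ (mulr_gt0 z0 e0)) := xl.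
  apply: filterS => n; rewrite -PiE; move: (norm_wold z (x - synthesis a n)).
  rewrite -PiE linearB => h1 h2; rewrite (le_lt_trans h1)//.
  by rewrite ltr_pdivrMl.
move: wx; under eq_fun do rewrite wa; move=> wx.
by apply: (cvg_unique _ wx (fa z)); exact: norm_hausdorff.
Qed.

Lemma exists_wold_unitary :
  exists2 Pi : {linear H -> (disc R -> W)}, @wold_unitary R H V Pi &
    (Pi : H -> disc R -> W) = wold.
Proof.
have [Pi PiE] := wold_linear_exists; exists Pi => //; split.
- rewrite PiE; apply/seteqP; split=> [_ [x _ <-]|f /wold_surjective[x <-]].
    exact: wold_hardy2.
  by exists x.
- by move=> x; rewrite PiE wold_sqrnorm.
- by move=> m w z; rewrite PiE wold_monomial.
Qed.

End WoldMap.

Section Intertwining.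
Local Open Scope complex_scope.
Local Open Scope classical_set_scope.
Context {R : realType} {H : hilbertType R} {V A : {linear H -> H}}.
Hypothesis iV : isometry inner inner V.
Hypothesis VA : forall x y, inner (V x) y = inner x (A y).
Hypothesis A0 : forall x, (fun n => iter n A x) @ \oo --> (0 : H).
Local Notation W := (subhilbert (wandering V)).
Local Notation proj0 := (wandering_proj iV VA).
Local Notation wld := (wold iV VA).

(** A bounded multiplier that agrees with [T] on the wandering subspace agrees
    with it everywhere: the difference [d] of the two sides vanishes on the
    wandering subspace and satisfies [d (V y) = z *: d y], so that
    [d x = z ^+ n *: d (iter n A x)], where [d] is bounded and [iter n A x]
    tends to 0. *)
Lemma wold_intertwine (T : {linear H -> H}) (Phi : disc R -> W -> W) :
    (forall x, T (V x) = V (T x)) -> isometry inner inner T ->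
    hardy_infty Phi ->
    (forall z w, Phi z w = wld (T (subval w)) z) ->
  forall x, wld (T x) = mult_op Phi (wld x).
Proof.
move=> TV iT [Phi_lin [c Phi_c] _] PhiE x; apply/funext => z.
rewrite /mult_op.
pose L := GRing.isLinear.Build R[i] W W *:%R (Phi z) (Phi_lin z).
pose S : {linear W -> W} := HB.pack (Phi z) L.
have SE w : S w = wld (T (subval w)) z := PhiE z w.
(* When [W] is trivial, the constant [c] of [hardy_infty] is arbitrary. *)
have Sc w : `|S w| <= `|c| * `|w|.
  rewrite -[X in _ * X]normr_id -normrM ger0_norm; first exact: Phi_c.
  exact: le_trans (Phi_c z w).
rewrite -[Phi z]/(S : W -> W).
have [Pi PiE] := wold_linear_exists iV VA A0.
pose d y : W := Pi (T y) z - S (Pi y z).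
have PiD u v : Pi (u + v) z = Pi u z + Pi v z by rewrite linearD.
have dD u v : d (u + v) = d u + d v.
  by rewrite /d linearD !PiD linearD opprD addrACA.
have dV y : d (V y) = sval z *: d y.
  by rewrite /d TV PiE !(wold_shift iV VA A0) linearZ/= scalerBr.
have dw (w : W) : d (subval w) = 0.
  by rewrite /d PiE -SE (wold_wandering iV VA A0) subrr.
have dA n y : d y = sval z ^+ n *: d (iter n A y).
  elim: n => [|n IH]; first by rewrite scale1r.
  rewrite IH -[iter n A y](subrK (V (A (iter n A y)))) dD.
  by rewrite (dw (proj0 _)) add0r dV scalerA -exprSr.
have db y : `|d y| <= (1 + `|c|) * (1 - `|sval z|)^-1 * `|y|.
  rewrite /d (le_trans (ler_normB _ _))// -mulrA mulrDl mul1r PiE lerD//.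
    by rewrite (le_trans (norm_wold iV VA A0 _ _))// (norm_isometry _ iT).
  by rewrite (le_trans (Sc _))// ler_wpM2l// norm_wold.
apply/eqP; rewrite -subr_eq0 -PiE; apply/eqP; rewrite -/(d x).
apply: (norm_le_cvg0 (c := (1 + `|c|) * (1 - `|sval z|)^-1) (A0 x)) => n.
rewrite (dA n) normrZ normrX.
rewrite (le_trans _ (db _))// ler_piMl// exprn_ile1// ltW//.
exact: (svalP z).
Qed.

End Intertwining.

(** * The block operator of a commuting pair *)
Section BlockOperator.
Local Open Scope complex_scope.
Local Open Scope classical_set_scope.
Context {R : realType} {H : hilbertType R} {V1 V2 A1 A2 : {linear H -> H}}.
Hypothesis iso1 : isometry inner inner V1.
Hypothesis iso2 : isometry inner inner V2.
Hypothesis V12 : forall x, V1 (V2 x) = V2 (V1 x).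
Hypothesis VA1 : forall x y, inner (V1 x) y = inner x (A1 y).
Hypothesis VA2 : forall x y, inner (V2 x) y = inner x (A2 y).
Local Notation W := (pair_wandering V1 V2).
Local Notation U := (block_unitary iso1 iso2 V12).
Local Notation P := (proj (wandering2 V1 V2)).
Implicit Type w : W.

Lemma isometry_comp : isometry inner inner (V1 \o V2).
Proof. by move=> x y /=; rewrite iso1; exact: iso2. Qed.

Lemma adjoint_comp x y : inner ((V1 \o V2) x) y = inner x ((A2 \o A1) y).
Proof. by rewrite /= VA1 VA2. Qed.

Lemma adjoint_commute x : A1 (A2 x) = A2 (A1 x).
Proof. by apply: inner_ext => u; rewrite -VA1 -VA2 -V12 VA1 VA2. Qed.

Lemma wandering_compE x : csset (wandering (V1 \o V2)) x <-> A2 (A1 x) = 0.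
Proof. exact: (wanderingE adjoint_comp). Qed.

Lemma coisometry2_wandering w : A2 (A1 (subval w)) = 0.
Proof. by apply/wandering_compE/cspredP/subvalP. Qed.

Lemma wandering_comp_in x :
  A2 (A1 x) = 0 -> x \in cspred (wandering (V1 \o V2)).
Proof. by move=> /wandering_compE ?; exact/cspredP. Qed.

(** As [V1 \o A1] projects onto the range of [V1], the three projections that
    occur in the theorem have closed formulas in terms of the isometries and
    their adjoints; every identity below is then a computation with the rules
    [A1 (V1 x) = x], [A2 (V2 x) = x], commutation, and [A2 (A1 w) = 0] on the
    wandering subspace of the pair. *)
Lemma proj_wandering1E w :
  subval (proj (wandering1 V1 V2) w) = subval w - V1 (A1 (subval w)).
Proof.
have A1q : A1 (subval w - V1 (A1 (subval w))) = 0.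
  by rewrite linearB/= (isometryK iso1 VA1) subrr.
have qW : subval w - V1 (A1 (subval w)) \in cspred (wandering (V1 \o V2)).
  by apply: wandering_comp_in; rewrite A1q linear0.
rewrite (@proj_unique _ _ _ _ (SubHilbert qW))// => [a b|/=|a].
- move=> /(wanderingE VA1) a0 /(wanderingE VA1) b0.
  by apply/(wanderingE VA1); rewrite /= linearB/= a0 b0 subrr.
- exact/(wanderingE VA1).
- move=> /(wanderingE VA1) a0.
  rewrite -[LHS]/(inner
    (subval w - (subval w - V1 (A1 (subval w)))) (subval a)).
  by rewrite subKr VA1 a0 linear0r.
Qed.

Lemma proj_wandering2E w : subval (P w) = subval w - V2 (A2 (subval w)).
Proof.
have A2q : A2 (subval w - V2 (A2 (subval w))) = 0.
  by rewrite linearB/= (isometryK iso2 VA2) subrr.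
have qW : subval w - V2 (A2 (subval w)) \in cspred (wandering (V1 \o V2)).
  by apply: wandering_comp_in; rewrite -adjoint_commute A2q linear0.
rewrite (@proj_unique _ _ _ _ (SubHilbert qW))// => [a b|/=|a].
- move=> /(wanderingE VA2) a0 /(wanderingE VA2) b0.
  by apply/(wanderingE VA2); rewrite /= linearB/= a0 b0 subrr.
- exact/(wanderingE VA2).
- move=> /(wanderingE VA2) a0.
  rewrite -[LHS]/(inner
    (subval w - (subval w - V2 (A2 (subval w)))) (subval a)).
  by rewrite subKr VA2 a0 linear0r.
Qed.

Lemma proj_V1_wandering2E w :
  subval (proj (V1_wandering2 V1 V2) w) = V1 (A1 (subval w)).
Proof.
have qW : V1 (A1 (subval w)) \in cspred (wandering (V1 \o V2)).
  apply: wandering_comp_in.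
  by rewrite (isometryK iso1 VA1) coisometry2_wandering.
rewrite (@proj_unique _ _ _ _ (SubHilbert qW))// => [a b|/=|a].
- move=> [u /(wanderingE VA2) u0 ua] [v /(wanderingE VA2) v0 vb].
  exists (u - v); last by rewrite linearB ua vb.
  by apply/(wanderingE VA2); rewrite linearB/= u0 v0 subrr.
- exists (A1 (subval w)) => //; apply/(wanderingE VA2).
  exact: coisometry2_wandering.
- move=> [u _ ua].
  rewrite -[LHS]/(inner (subval w - V1 (A1 (subval w))) (subval a)) -ua.
  rewrite inner_conj VA1 linearB/= (isometryK iso1 VA1) subrr.
  by rewrite linear0r rmorph0.
Qed.

Lemma block_unitaryE w : subval (U w) =
  V2 (subval w) - V2 (V1 (A1 (subval w))) + A1 (subval w).
Proof.
rewrite -[LHS]/(V2 _ + adjoint V1 _) proj_wandering1E proj_V1_wandering2E.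
by rewrite adjoint_isometryK// linearB.
Qed.

(** The formula of [block_unitaryE] with the indices 1 and 2 exchanged: the
    inverse, [V1] on W2 and [A2] on V2 W1, is the block operator of the pair
    (V2, V1). *)
Fact block_adjointP w :
  V1 (subval w) - V1 (V2 (A2 (subval w))) + A2 (subval w)
    \in cspred (wandering (V1 \o V2)).
Proof.
apply: wandering_comp_in; rewrite linearD linearB/= !(isometryK iso1 VA1).
rewrite linearD linearB/= (isometryK iso2 VA2) subrr add0r.
by rewrite adjoint_commute coisometry2_wandering linear0.
Qed.

Definition block_adjoint w : W := SubHilbert (block_adjointP w).

Lemma block_adjointE w : subval (block_adjoint w) =
  V1 (subval w) - V1 (V2 (A2 (subval w))) + A2 (subval w).
Proof. by []. Qed.

Lemma inner_block_unitary w w' : inner (U w) w' = inner w (block_adjoint w').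
Proof.
rewrite -[LHS]/(inner (subval (U w)) (subval w')) block_unitaryE.
rewrite -[RHS]/(inner (subval w) (subval (block_adjoint w'))) /=.
rewrite linearDl/= linearBl/= [RHS]linearDr/= [in RHS]linearBr/=.
have A1V (x y : H) : inner x (V1 y) = inner (A1 x) y.
  by rewrite inner_conj VA1 -inner_conj.
have A2V (x y : H) : inner x (V2 y) = inner (A2 x) y.
  by rewrite inner_conj VA2 -inner_conj.
rewrite !VA2 VA1 adjoint_commute coisometry2_wandering linear0r subr0.
rewrite !A1V A2V coisometry2_wandering linear0l subr0.
by rewrite addrC.
Qed.

Lemma coisometry_block_unitary w :
  A2 (subval (U w)) = subval w - V1 (A1 (subval w)).
Proof.
rewrite block_unitaryE linearD/= coisometry2_wandering addr0.
by rewrite -(linearB V2)/= (isometryK iso2 VA2).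
Qed.

Lemma block_unitaryK : cancel U block_adjoint.
Proof.
move=> w; apply: val_inj; rewrite -[LHS]/(subval _) block_adjointE.
rewrite coisometry_block_unitary block_unitaryE -(linearB V2)/=.
by rewrite (linearD V1)/= [X in X + _]addrAC subrr add0r addrC subrK.
Qed.

Lemma block_adjointK : cancel block_adjoint U.
Proof.
move=> w; apply: val_inj; rewrite -[LHS]/(subval _) block_unitaryE.
rewrite block_adjointE -(linearB V1)/=.
set q := subval w - V2 (A2 (subval w)).
have -> : A1 (V1 q + A2 (subval w)) = q.
  rewrite linearD/= (isometryK iso1 VA1) adjoint_commute.
  by rewrite coisometry2_wandering addr0.
by rewrite (linearD V2)/= [X in X + _]addrAC subrr add0r addrC subrK.
Qed.

Lemma adjoint_block_unitary : adjoint U = block_adjoint.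
Proof. exact: adjoint_unique inner_block_unitary. Qed.

Lemma block_unitary_linear : linear U.
Proof.
move=> a x y; apply: val_inj.
rewrite -[LHS]/(subval _) -[RHS]/(a *: subval (U x) + subval (U y)).
rewrite !block_unitaryE -[subval (a *: x + y)]/(a *: subval x + subval y).
rewrite !linearP/= !scalerDr.
by rewrite [X in X + _ = _]addrACA [LHS]addrACA.
Qed.

Lemma block_adjoint_linear : linear block_adjoint.
Proof.
move=> a x y; apply: (can_inj block_unitaryK).
by rewrite block_unitary_linear !block_adjointK.
Qed.

Lemma norm_block_unitary w : `|U w| = `|w|.
Proof.
apply/eqP; rewrite -(@eqrXn2 _ 2)// -!inner_norm.
by rewrite inner_block_unitary block_unitaryK.
Qed.

Lemma norm_block_adjoint w : `|block_adjoint w| = `|w|.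
Proof. by rewrite -norm_block_unitary block_adjointK. Qed.

Lemma unitary_block_unitary : unitary_operator U.
Proof.
split.
- apply: contraction_bounded_operator; first exact: block_unitary_linear.
  by move=> x; rewrite norm_block_unitary.
- by rewrite adjoint_block_unitary; exact: block_unitaryK.
- by rewrite adjoint_block_unitary; exact: block_adjointK.
Qed.

End BlockOperator.

(** * The multipliers of the pair *)
Section BCL.
Local Open Scope complex_scope.
Local Open Scope classical_set_scope.
Context {R : realType} {H : hilbertType R} {V1 V2 A1 A2 : {linear H -> H}}.
Hypothesis iso1 : isometry inner inner V1.
Hypothesis iso2 : isometry inner inner V2.
Hypothesis V12 : forall x, V1 (V2 x) = V2 (V1 x).
Hypothesis VA1 : forall x y, inner (V1 x) y = inner x (A1 y).
Hypothesis VA2 : forall x y, inner (V2 x) y = inner x (A2 y).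
Local Notation W := (pair_wandering V1 V2).
Local Notation U := (block_unitary iso1 iso2 V12).
Local Notation Us := (block_adjoint iso1 iso2 V12 VA1 VA2).
Local Notation P := (proj (wandering2 V1 V2)).
Local Notation Pperp := (fun w : W => w - P w).
Implicit Type w : W.

Lemma proj_perp_wandering2E w : subval (Pperp w) = V2 (A2 (subval w)).
Proof.
rewrite -[LHS]/(subval w - subval (P w)) (proj_wandering2E iso2 V12 VA1 VA2).
by rewrite subKr.
Qed.

Lemma proj_wandering2_linear : linear P.
Proof.
move=> a x y; apply: val_inj.
rewrite -[LHS]/(subval _) -[RHS]/(a *: subval (P x) + subval (P y)).
rewrite !(proj_wandering2E iso2 V12 VA1 VA2).
exact: (congr1 val (wandering_proj_linear iso2 VA2 a (subval x) (subval y))).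
Qed.

Lemma proj_perp_wandering2_linear : linear Pperp.
Proof.
move=> a x y; rewrite proj_wandering2_linear scalerBr opprD.
by rewrite addrACA.
Qed.

Lemma norm_proj_wandering2 w : `|P w| <= `|w|.
Proof.
rewrite -[leLHS]/(`|subval (P w)|) (proj_wandering2E iso2 V12 VA1 VA2).
exact: (norm_wandering_proj iso2 VA2).
Qed.

Lemma norm_proj_perp_wandering2 w : `|Pperp w| <= `|w|.
Proof.
rewrite -[leLHS]/(`|subval (Pperp w)|) proj_perp_wandering2E.
by rewrite (norm_isometry _ iso2); exact: (norm_coisometry iso2 VA2).
Qed.

(** The vector [P w] lies in W2, where the inverse of the block operator acts
    as [V1]; the vector [w - P w] is the image under [V2] of a vector of W1, to
    which the inverse brings it back. *)
Lemma V1_decomposition w :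
  V1 (subval w) =
    subval (Us (P w)) + V1 (V2 (subval (Us (Pperp w)))).
Proof.
rewrite !block_adjointE proj_perp_wandering2E.
rewrite (proj_wandering2E iso2 V12 VA1 VA2) !(isometryK iso2 VA2).
have -> : A2 (subval w - V2 (A2 (subval w))) = 0.
  by rewrite linearB/= (isometryK iso2 VA2) subrr.
rewrite !linear0 !addr0 subrr add0r.
by rewrite (linearB V1)/= subrK.
Qed.

(** If [w = w1 + V1 w2], with [w1] in W1 and [w2] in W2, then the block operator
    sends [w] to [V2 w1 + w2], and [P] separates these two terms. *)
Lemma V2_decomposition w :
  V2 (subval w) =
    subval (Pperp (U w)) + V1 (V2 (subval (P (U w)))).
Proof.
rewrite proj_perp_wandering2E (proj_wandering2E iso2 V12 VA1 VA2).
rewrite (coisometry_block_unitary iso1 iso2 V12 VA1 VA2).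
rewrite (block_unitaryE iso1 iso2 V12 VA1 VA2) -(linearB V2)/=.
set q := subval w - V1 (A1 (subval w)).
by rewrite [V2 q + _ - _]addrAC subrr add0r V12 -(linearD V2)/= subrK.
Qed.

End BCL.

Theorem theorem3p3 (R : realType) (H : hilbertType R) (V1 V2 : {linear H -> H})
    (iso1 : isometry inner inner V1) (iso2 : isometry inner inner V2)
    (V12 : forall x : H, V1 (V2 x) = V2 (V1 x)) (pureV : pure_pair V1 V2) :
  let U := block_unitary iso1 iso2 V12 in
  let P := proj (wandering2 V1 V2) in
  let Pperp := fun w : pair_wandering V1 V2 => w - P w in
  unitary_operator U /\
  forall Phi1 Phi2 : disc R -> pair_wandering V1 V2 -> pair_wandering V1 V2,
    bcl_pair Phi1 Phi2 <->
    forall (z : disc R) (w : pair_wandering V1 V2),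
      Phi1 z w = adjoint U (P w + sval z *: Pperp w) /\
      Phi2 z w = Pperp (U w) + sval z *: P (U w).
Proof.
have [A1 VA1] := exists_linear_adjoint iso1.
have [A2 VA2] := exists_linear_adjoint iso2.
have iV := isometry_comp iso1 iso2.
have VA := adjoint_comp VA1 VA2.
have A0 x : ((fun n => iter n (A2 \o A1) x) @ \oo --> (0 : H))%classic.
  by rewrite -(adjoint_unique VA); exact: pureV.
pose Us := block_adjoint iso1 iso2 V12 VA1 VA2.
move=> U P Pperp; split.
  exact: unitary_block_unitary VA1 VA2.
rewrite (adjoint_block_unitary iso1 iso2 V12 VA1 VA2) -/Us.
have UsL : linear Us by exact: block_adjoint_linear.
have UL : linear U by exact: block_unitary_linear.
pose F1 (z : disc R) w := Us (P w) + sval z *: Us (Pperp w).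
pose F2 (z : disc R) w := Pperp (U w) + sval z *: P (U w).
have F1E z w : Us (P w + sval z *: Pperp w) = F1 z w.
  by rewrite addrC UsL addrC.
have V1E w : V1 (subval w) =
    subval (Us (P w)) + (V1 \o V2) (subval (Us (Pperp w))).
  exact: V1_decomposition.
have V2E w : V2 (subval w) =
    subval (Pperp (U w)) + (V1 \o V2) (subval (P (U w))).
  exact: V2_decomposition.
(* The values at [p] and [V q] are the cases [m = 0] and [m = 1] of the
   defining property of a Wold unitary. *)
have PiE (Pi : {linear H -> (disc R -> pair_wandering V1 V2)}) p q z :
    @wold_unitary R H (V1 \o V2) Pi ->
    Pi (subval p + (V1 \o V2) (subval q)) z = p + sval z *: q.
  move=> [_ _ mono]; have := mono 0%N p z; have := mono 1%N q z.
  rewrite expr1 expr0 scale1r /= => <- {2}<-.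
  by rewrite linearD.
move=> Phi1 Phi2; split.
- move=> [_ _ [Pi PiW PiV]] z w.
  have Piw : Pi (subval w) z = w.
    by case: PiW => _ _ /(_ 0%N w z); rewrite expr0 scale1r.
  rewrite F1E; split.
    by rewrite -{1}Piw -[LHS]/(mult_op Phi1 (Pi (subval w)) z)
      -(PiV (subval w)).1 V1E (PiE _ _ _ _ PiW).
  by rewrite -{1}Piw -[LHS]/(mult_op Phi2 (Pi (subval w)) z)
      -(PiV (subval w)).2 V2E (PiE _ _ _ _ PiW).
- move=> PhiE.
  have -> : Phi1 = F1.
    by apply/funext => z; apply/funext => w; rewrite (PhiE z w).1 F1E.
  have -> : Phi2 = F2.
    by apply/funext => z; apply/funext => w; rewrite (PhiE z w).2.
  have hF1 : hardy_infty F1.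
    apply: affine_hardy_infty.
    + move=> a x y; rewrite -UsL; congr Us.
      exact: (proj_wandering2_linear iso2 V12 VA1 VA2).
    + move=> a x y; rewrite -UsL; congr Us.
      exact: (proj_perp_wandering2_linear iso2 V12 VA1 VA2).
    + move=> x; rewrite norm_block_adjoint.
      exact: (norm_proj_wandering2 iso2 V12 VA1 VA2).
    + move=> x; rewrite norm_block_adjoint.
      exact: (norm_proj_perp_wandering2 iso2 V12 VA1 VA2).
  have hF2 : hardy_infty F2.
    apply: affine_hardy_infty.
    + move=> a x y; rewrite UL.
      exact: (proj_perp_wandering2_linear iso2 V12 VA1 VA2).
    + move=> a x y; rewrite UL.
      exact: (proj_wandering2_linear iso2 V12 VA1 VA2).
    + move=> x; rewrite -(norm_block_unitary iso1 iso2 V12 VA1 VA2 x).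
      exact: (norm_proj_perp_wandering2 iso2 V12 VA1 VA2).
    + move=> x; rewrite -(norm_block_unitary iso1 iso2 V12 VA1 VA2 x).
      exact: (norm_proj_wandering2 iso2 V12 VA1 VA2).
  have [Pi PiW PiX] := exists_wold_unitary iV VA A0.
  split=> //; exists Pi => // x; rewrite PiX; split.
    apply: wold_intertwine => //.
    + by move=> y /=; rewrite (V12 y).
    + by move=> z w; rewrite -PiX V1E PiE.
  apply: wold_intertwine => //.
  + by move=> y /=; rewrite (V12 (V2 y)).
  + by move=> z w; rewrite -PiX V2E PiE.
Qed.
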